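(* Suppose that $G$ is a sparse $n \times n$ crossword grid with no black squares on the edges (i.e. no black square in row $1$, row $n$, column $1$ or column $n$). Then there is a bijection between the set of complete non-attacking rook placements on $G$ and the set of $n \times n$ alternating sign matrices whose set of positions of the entries equal to $-1$ is the same as the set of positions of the black squares in $G$.
   Context: An $n \times n$ crossword grid is an $n\times n$ array of squares, each white or black; squares are indexed by (row, column) as in a matrix. An across word is a maximal (non-empty) contiguous sequence of white squares within a single row; a down word is a maximal (non-empty) contiguous sequence of white squares within a single column. A complete non-attacking rook placement on $G$ is a subset of the white squares of $G$ containing exactly one square of every across word and exactly one square of every down word. A crossword grid is sparse if no two black squares share an edge. An alternating sign matrix is a square matrix with entries in $\{0,+1,-1\}$ in which every row and column sums to $1$ and the nonzero entries in each row and each column alternate in sign. *)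

(* Defs.v *)
From mathcomp Require Import all_boot all_order all_algebra.

Set Implicit Arguments.
Unset Strict Implicit.
Unset Printing Implicit Defensive.

Import Order.TTheory GRing.Theory Num.Theory.

(* The pair (i, j) is the square in row i, column j, numbered from 0. *)
Notation square n := ('I_n * 'I_n)%type.

(* G i j is true when square (i, j) is black. *)
Definition crossword (n : nat) : Type := 'M[bool]_n.

Section Crossword.

Variables (n : nat) (G : crossword n).

Definition black_squares : {set square n} := [set s : square n | G s.1 s.2].

Definition white_squares : {set square n} := [set s : square n | ~~ G s.1 s.2].

Definition row_segment (i a b : 'I_n) : {set square n} :=
  [set s : square n | (s.1 == i) && (a <= s.2 <= b)].

Definition col_segment (j a b : 'I_n) : {set square n} :=
  [set s : square n | (s.2 == j) && (a <= s.1 <= b)].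

(* The condition a <= b makes the runs non-empty. *)
Definition white_row_run (W : {set square n}) : bool :=
  (W \subset white_squares) &&
  [exists i, exists a : 'I_n, exists b : 'I_n,
    (a <= b) && (W == row_segment i a b)].

Definition white_col_run (W : {set square n}) : bool :=
  (W \subset white_squares) &&
  [exists j, exists a : 'I_n, exists b : 'I_n,
    (a <= b) && (W == col_segment j a b)].

Definition across_word (W : {set square n}) : bool := maxset white_row_run W.

Definition down_word (W : {set square n}) : bool := maxset white_col_run W.

Definition complete_rook_placement (R : {set square n}) : bool :=
  [&& R \subset white_squares,
      [forall W, across_word W ==> (#|R :&: W| == 1)]
    & [forall W, down_word W ==> (#|R :&: W| == 1)]].

Definition share_edge (s t : square n) : bool :=
  ((s.1 == t.1) && ((s.2.+1 == t.2) || (t.2.+1 == s.2))) ||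
  ((s.2 == t.2) && ((s.1.+1 == t.1) || (t.1.+1 == s.1))).

Definition sparse : Prop :=
  forall s t, s \in black_squares -> t \in black_squares -> ~~ share_edge s t.

Definition on_border (s : square n) : bool :=
  [|| s.1 == 0 :> nat, s.1.+1 == n, s.2 == 0 :> nat | s.2.+1 == n].

Definition no_black_on_border : Prop :=
  forall s, s \in black_squares -> ~~ on_border s.

End Crossword.

Local Open Scope ring_scope.

(* Consecutive nonzero entries have opposite signs. *)
Definition alternating (s : seq int) : bool :=
  sorted (fun x y : int => x * y < 0) [seq x <- s | x != 0].

Definition asm (n : nat) (A : 'M[int]_n) : bool :=
  [&& [forall i, forall j, A i j \in [:: 0; 1; -1]],
      [forall i, \sum_j A i j == 1],
      [forall j, \sum_i A i j == 1],
      [forall i, alternating [seq A i j | j <- enum 'I_n]]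
    & [forall j, alternating [seq A i j | i <- enum 'I_n]]].

Definition minus_one_positions (n : nat) (A : 'M[int]_n) : {set square n} :=
  [set s : square n | A s.1 s.2 == -1].

(* Main.v *)
(* A rook placement R is sent to the matrix with 1 on R, -1 on the black squares
   and 0 elsewhere.  A line with entries in {0, 1, -1} alternates in sign and sums
   to 1 exactly when its partial sums all lie in {0, 1} and end at 1.  Partial
   sums drop only at black squares, and every word of the line is bounded by black
   squares or by the border, so this says that the partial sum rises from 0 to 1
   exactly once inside each word, i.e. that each word holds exactly one rook.
   Sparsity and the absence of black squares on the border make sure that a
   non-empty word lies before, between and after the black squares. *)
Require Import Defs.
From mathcomp Require Import all_boot all_order all_algebra.
From mathcomp Require Import zify.

Set Implicit Arguments.
Unset Strict Implicit.
Unset Printing Implicit Defensive.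

Import Order.TTheory GRing.Theory Num.Theory.

Local Open Scope ring_scope.

(** * Alternating sequences and their partial sums *)

Definition sign_entry : pred int := [in [:: 0; 1; -1]].

Lemma sign_entryP x : sign_entry x -> [\/ x = 0, x = 1 | x = -1].
Proof. by case/or4P=> // /eqP->; [constructor 1|constructor 2|constructor 3]. Qed.

Definition opp_signs (x y : int) : bool := x * y < 0.

(** The accumulator [c] is the sum of the entries already read, so the recursion tests the partial
    sums from left to right. *)
Fixpoint prefix01 (c : int) (s : seq int) : bool :=
  (c \in [:: 0; 1]) && if s is x :: s' then prefix01 (c + x) s' else c == 1.

(** Alternating terms cancel in pairs, so only the first nonzero entry can survive in the sum. The
    two cases go together because each nonzero entry leads from one to the other. *)
Lemma path_sum_bounds (s : seq int) : all sign_entry s ->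
  let t := [seq x <- s | x != 0] in
  (path opp_signs 1 t -> \sum_(x <- s) x \in [:: 0; -1]) /\
  (path opp_signs (-1) t -> \sum_(x <- s) x \in [:: 0; 1]).
Proof.
elim: s => [|x s IHs] /=; first by rewrite big_nil.
case/andP=> /sign_entryP + /IHs [IH1 IHN]; rewrite big_cons.
case=> -> /=; rewrite ?add0r // /opp_signs.
- by split=> //= /IH1; rewrite !inE => /orP[] /eqP->.
- by split=> //= /IHN; rewrite !inE => /orP[] /eqP->.
Qed.

(** While the partial sums stay in {0, 1}, they remember the last sign: the sum is 1 just after a 1
    and 0 just after a -1. It can therefore stand for the previous entry in [path]. *)
Lemma prefix01_path (s : seq int) : all sign_entry s ->
  let t := [seq x <- s | x != 0] in
  (prefix01 1 s = path opp_signs 1 t && (\sum_(x <- s) x == 0)) /\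
  (prefix01 0 s = path opp_signs (-1) t && (\sum_(x <- s) x == 1)).
Proof.
elim: s => [|x s IHs] /=; first by rewrite big_nil.
case/andP=> /sign_entryP + /IHs [IH1 IHN]; rewrite big_cons.
case=> -> /=; rewrite ?add0r ?addr0 // /opp_signs /=.
- rewrite IH1; split; last by congr (_ && _); rewrite [RHS]eq_sym addrC -subr_eq subrr eq_sym.
  (* The partial sum is 2 here and fails the test for every [s]; the case analysis only lets the
     fixpoint unfold. *)
  by case: s {IHs IH1 IHN}.
- rewrite IHN; split; first by congr (_ && _); rewrite addrC subr_eq0.
  by case: s {IHs IH1 IHN}.
Qed.

(** Alternation leaves the first sign free. A leading -1 is excluded by the sum: the alternating
    rest adds at most 1, so the total cannot reach 1. *)
Lemma prefix01P (s : seq int) : all sign_entry s ->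
  prefix01 0 s = alternating s && (\sum_(x <- s) x == 1).
Proof.
rewrite /alternating; elim: s => [|x s IHs] /=; first by rewrite big_nil.
case/andP=> /sign_entryP + sP; have [H1 _] := prefix01_path sP.
have [_ HN] := path_sum_bounds sP.
rewrite big_cons; case=> -> /=; rewrite ?add0r ?IHs //.
- by rewrite H1; congr (_ && _); rewrite [RHS]eq_sym addrC -subr_eq subrr eq_sym.
- have -> : prefix01 (-1) s = false by case: (s).
  by apply/esym/negP=> /andP[/HN]; rewrite !inE => /orP[] /eqP->.
Qed.

Lemma prefix01_iota (v : nat -> int) (k m : nat) :
  let D j := \sum_(0 <= i < j) v i in
  reflect ((forall j, (k <= j <= k + m)%N -> D j \in [:: 0; 1]) /\ D (k + m)%N = 1)
          (prefix01 (D k) [seq v i | i <- iota k m]).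
Proof.
move=> D; elim: m k => [|m IHm] k /=.
  rewrite addn0; apply: (iffP andP) => [[Dk /eqP Dk1]|[DP ->]] //.
  split=> // j jk; suff -> : j = k by []. lia.
have -> : D k + v k = D k.+1 by rewrite /D big_nat_recr.
apply: (iffP andP) => [[Dk /IHm[DP D1]]|[DP D1]].
  rewrite -addSnnS; split=> // j jk; have [->//|neq] := eqVneq j k.
  apply: DP; lia.
split; first by apply: DP; lia.
by apply/IHm; rewrite addSnnS; split=> // j jk; apply: DP; lia.
Qed.

(** * Words on a single line *)

(** The word is the half-open interval from [a] to [e], matching the ranges of big sums; [e] is the
    first position after it. *)
Definition line_word (n : nat) (b : nat -> bool) (a e : nat) : Prop :=
  [/\ (a < e <= n)%N, (a == 0)%N || b a.-1, (e == n) || b e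
    & forall k, (a <= k < e)%N -> ~~ b k].

Section Line.

Variables (n : nat) (b r : nat -> bool).

Let D k : int := \sum_(0 <= i < k) ((r i)%:Z - (b i)%:Z).

Let DS k : D k.+1 = D k + ((r k)%:Z - (b k)%:Z).
Proof. by rewrite /D big_nat_recr. Qed.

Let D_white a e : (a <= e)%N -> (forall k, (a <= k < e)%N -> ~~ b k) ->
  D e = D a + (\sum_(a <= i < e) r i)%N%:Z.
Proof.
elim: e => [|e IHe]; first by rewrite leqn0 => /eqP-> _; rewrite big_geq ?addr0.
rewrite leq_eqVlt => /predU1P[->|ae] wh; first by rewrite big_geq ?addr0.
have /negbTE be : ~~ b e by apply: wh; lia.
rewrite DS IHe // => [|k kP]; last by apply: wh; lia.
by rewrite big_nat_recr //= be PoszD; lia.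
Qed.

Hypothesis rb : forall k, r k -> ~~ b k.

(** A black square carries no rook and lowers [D] by 1, so [D] must be 1 just before it and 0 just
    after it. Hence [D] goes from 0 to 1 along a word, and on white squares its growth counts
    rooks. *)
Lemma prefix01_word a e :
    (forall k, (k <= n)%N -> D k \in [:: 0; 1]) -> D n = 1 ->
  line_word n b a e -> (\sum_(a <= i < e) r i = 1)%N.
Proof.
move=> DP Dn [/andP[ae en] aP eP wh].
have := D_white (ltnW ae) wh.
have -> : D a = 0.
  case: a aP ae {wh} => [|a] /= aP ae; first by rewrite /D big_geq.
  have := DP a.+1; have := DP a; have := rb (k := a).
  rewrite DS aP !inE; case: (r a) => [/(_ isT)//|_] /=; lia.
suff -> : D e = 1 by lia.
case/predU1P: eP => [->//|be]; case: (ltngtP e n) en => // [en _|-> //].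
have := DP e.+1 en; have := DP e (ltnW en); have := rb (k := e).
rewrite DS be !inE; case: (r e) => [/(_ isT)//|_] /=; lia.
Qed.

Hypothesis b_sparse : forall k, b k -> ~~ b k.+1.
Hypothesis b_first : ~~ b 0.
Hypothesis b_last : ~~ b n.-1.
Hypothesis words : forall a e, line_word n b a e -> (\sum_(a <= i < e) r i = 1)%N.

Let last_start k : (k <= n)%N ->
  exists a, [/\ (a <= k)%N, (a == 0)%N || b a.-1,
                forall i, (a <= i < k)%N -> ~~ b i & D a = 0].
Proof.
elim: k => [|k IHk] kn; first by exists 0%N; split=> //; rewrite /D big_geq.
have [a [ak aP wh Da]] := IHk (ltnW kn).
case: (boolP (b k)) => bk; last first.
  exists a; split=> //; first by lia.
  by move=> i iP; have [->//|ik] := eqVneq i k; apply: wh; lia.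
exists k.+1; split=> //=; first by move=> i; lia.
(* The white stretch before the black square [k] is not empty: otherwise the first square would be
   black or two black squares would be adjacent. *)
have lt_ak : (a < k)%N.
  rewrite ltn_neqAle ak andbT; apply/eqP=> eq_ak; subst k.
  case: (a) aP bk => [_|a' /= ba' ba]; first by rewrite (negbTE b_first).
  by have := b_sparse ba'; rewrite ba.
have w : line_word n b a k by split=> //; rewrite ?bk ?orbT //; lia.
(* The word adds 1 and the black square takes it back, so the partial sum is 0 again after [k]. *)
have := rb (k := k); rewrite DS (D_white ak wh) Da words // bk.
by case: (r k) => // /(_ isT).
Qed.

Let next_end k : (k <= n)%N ->
  exists e, [/\ (k <= e <= n)%N, (e == n) || b e
                & forall i, (k <= i < e)%N -> ~~ b i].
Proof.
move=> kn; have [m] := ubnP (n - k); elim: m k kn => // m IHm k kn mP.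
case: (boolP ((k == n) || b k)) => [kP|/norP[k_n bk]].
  by exists k; split=> //; [lia|move=> i; lia].
have [||e [ke eP wh]] := IHm k.+1; try lia.
exists e; split=> //; first by lia.
by move=> i iP; have [->//|ik] := eqVneq i k; apply: wh; lia.
Qed.

(** Since [D] vanishes at the last word start [a], its value at [k] counts the rooks from [a] up to
    [k]. These lie in an initial part of one word, so there is at most one. *)
Lemma word_prefix01 : (0 < n)%N ->
  (forall k, (k <= n)%N -> D k \in [:: 0; 1]) /\ D n = 1.
Proof.
move=> n_gt0; split=> [k kn|].
  have [a [ak aP wh Da]] := last_start kn.
  rewrite (D_white ak wh) Da add0r.
  have [ak'|ka] := ltnP a k; last by rewrite big_geq.
  have [e [ke eP wh']] := next_end kn.
  have : line_word n b a e.
    split=> //; first by lia.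
    move=> i iP; have [ik|ki] := ltnP i k; first by apply: wh; lia.
    by apply: wh'; lia.
  move/words; rewrite (big_cat_nat ak) /=; last by lia.
  by rewrite !inE => H; lia.
have [a [an aP wh Da]] := last_start (leqnn n).
(* The last square is white, so the stretch that ends at [n] is a genuine word and brings the sum to
   1. *)
have lt_an : (a < n)%N.
  rewrite ltn_neqAle an andbT; apply/eqP=> eq_an; subst a.
  by case: (n) aP n_gt0 b_last => // m /= ->.
by rewrite (D_white an wh) Da words ?add0r //; split=> //; lia.
Qed.

End Line.

(* [t] is the identity for rows and the transposition of squares for columns;
   both instances are convertible to the definitions for rows and columns. *)
Section Orientation.

Variables (n : nat) (G : crossword n) (t : square n -> square n).
Hypothesis tK : involutive t.

Definition oriented_segment (i a c : 'I_n) : {set square n} :=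
  [set s | ((t s).1 == i) && (a <= (t s).2 <= c)%N].

Definition oriented_run (W : {set square n}) : bool :=
  (W \subset white_squares G) &&
  [exists i, exists a : 'I_n, exists c : 'I_n,
    (a <= c)%N && (W == oriented_segment i a c)].

Implicit Types i a c k : 'I_n.

Let B (i j : 'I_n) : bool := G (t (i, j)).1 (t (i, j)).2.

Lemma in_oriented_segment i a c i' k :
  (t (i', k) \in oriented_segment i a c) = (i' == i) && (a <= k <= c)%N.
Proof. by rewrite inE tK. Qed.

Lemma segment_white i a c :
  reflect (forall k, (a <= k <= c)%N -> ~~ B i k)
          (oriented_segment i a c \subset white_squares G).
Proof.
apply: (iffP subsetP) => [wh k kP|wh s].
  by have := wh (t (i, k)); rewrite in_oriented_segment eqxx inE => /(_ kP).
rewrite -(tK s); case: (t s) => i' k; rewrite in_oriented_segment.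
by case/andP=> /eqP-> /wh; rewrite inE.
Qed.

Lemma oriented_runP W :
  reflect (exists i a c : 'I_n, [/\ (a <= c)%N, W = oriented_segment i a c
                           & forall k, (a <= k <= c)%N -> ~~ B i k])
          (oriented_run W).
Proof.
apply: (iffP andP) => [[Ww /existsP[i /existsP[a /existsP[c /andP[ac /eqP E]]]]]|].
  by exists i, a, c; split=> //; apply/segment_white; rewrite -E.
case=> i [a [c [ac -> /segment_white wh]]]; split=> //.
by apply/existsP; exists i; apply/existsP; exists a; apply/existsP; exists c; rewrite ac /=.
Qed.

End Orientation.

(** * Words of the grid and signs along its lines *)

Definition rook_sign n (G : crossword n) (R : {set square n}) (s : square n) : int :=
  (s \in R)%:Z - (G s.1 s.2)%:Z.

Lemma rook_sign_entry n (G : crossword n) (R : {set square n}) s :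
  sign_entry (rook_sign G R s).
Proof. by rewrite /rook_sign; case: (_ \in R); case: (G _ _). Qed.

Section Words.
Variables (m : nat) (G : crossword m.+1) (t : square m.+1 -> square m.+1).
Hypothesis tK : involutive t.
Local Notation n := m.+1.
(** Outside the line [inord] returns a default index; the guard [k < n] keeps [B] false there. *)
Let B (i : 'I_n) (k : nat) : bool := (k < n)%N && G (t (i, inord k)).1 (t (i, inord k)).2.

Let B_ord i (k : 'I_n) : B i k = G (t (i, k)).1 (t (i, k)).2.
Proof. by rewrite /B ltn_ord inord_val. Qed.

Lemma max_oriented_runP W :
  reflect (exists i (a c : 'I_n), W = oriented_segment t i a c /\
             line_word n (B i) a c.+1)
          (maxset (oriented_run G t) W).
Proof.
apply: (iffP maxsetP).
  case=> /(oriented_runP _ tK)[i [a [c [ac -> wh]]]] Wmax; exists i, a, c; split=> //.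
  split.
  - by rewrite ltnS ac ltn_ord.
  - apply/norP=> -[a0 Ba].
    have a1n : (a.-1 < n)%N by have := ltn_ord a; lia.
    pose a' : 'I_n := Ordinal a1n.
    (* If the square before [a] were white, the run could be extended by it. Maximality would equate
       the two runs, yet only the longer one contains [t (i, a')]. *)
    suff E : oriented_segment t i a' c = oriented_segment t i a c.
      have : t (i, a') \in oriented_segment t i a c.
        rewrite -E in_oriented_segment // eqxx leqnn /=; lia.
      by rewrite in_oriented_segment // => /and3P[_ /= H1 _]; lia.
    apply: Wmax.
      apply/(oriented_runP _ tK); exists i, a', c; split=> //; first by move=> /=; lia.
      move=> k /= kP; have [ak|ka] := leqP a k; first by apply: wh; lia.
      suff -> : k = a' by move: Ba; rewrite -B_ord.
      by apply: val_inj => /=; lia.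
    apply/subsetP=> s; rewrite !inE /= => /and3P[-> /= aP ->]; lia.
  - apply/norP=> -[c_n Bc].
    have c1n : (c.+1 < n)%N by have := ltn_ord c; lia.
    pose c' : 'I_n := Ordinal c1n.
    suff E : oriented_segment t i a c' = oriented_segment t i a c.
      have : t (i, c') \in oriented_segment t i a c.
        rewrite -E in_oriented_segment // eqxx leqnn /=; lia.
      by rewrite in_oriented_segment // => /and3P[_ _ /=]; lia.
    apply: Wmax.
      apply/(oriented_runP _ tK); exists i, a, c'; split=> //; first by move=> /=; lia.
      move=> k /= kP; have [kc|ck] := leqP k c; first by apply: wh; lia.
      suff -> : k = c' by move: Bc; rewrite -B_ord.
      by apply: val_inj => /=; lia.
    apply/subsetP=> s; rewrite !inE /= => /and3P[-> /= aP cP]; lia.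
  - move=> k kP; have kn : (k < n)%N by have := ltn_ord c; lia.
    by rewrite -[k]/(val (Ordinal kn)) B_ord; apply: wh => /=; lia.
case=> i [a [c [-> [/andP[ac _] aP cP wh]]]]; split.
  apply/(oriented_runP _ tK); exists i, a, c; split=> // k kP.
  by rewrite -B_ord; apply: wh; lia.
move=> W' /(oriented_runP _ tK)[i' [a' [c' [ac' -> wh']]]] /subsetP sub.
(* A larger run contains both ends of the word, so it lies on the same line and covers the range
   from [a] to [c]. Were it strictly wider, it would contain a black neighbour of the word. *)
have := sub (t (i, a)); have := sub (t (i, c)).
rewrite !in_oriented_segment // eqxx /= !leqnn andbT => /(_ _)/andP[//|/eqP Ei cP']; subst i'.
move=> /(_ _)/andP[//|_ aP'].
suff [-> ->] : a' = a /\ c' = c by [].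
have {}wh' k : (a' <= k <= c')%N -> ~~ B i k.
  move=> kP; have kn : (k < n)%N by have := ltn_ord c'; lia.
  by rewrite -[k]/(val (Ordinal kn)) B_ord; apply: wh' => /=; lia.
split; apply/val_inj/anti_leq.
  have [//|lt_a'a] := leqP a a'; first by move=> /=; lia.
  case/orP: aP => [|Ba]; first by lia.
  by have /negP[] : ~~ B i a.-1 by apply: wh'; lia.
have [//|lt_cc'] := leqP c' c; first by move=> /=; lia.
case/orP: cP => [/eqP|Bc]; first by have := ltn_ord c'; lia.
by have /negP[] : ~~ B i c.+1 by apply: wh'; lia.
Qed.

Variable R : {set square n}.
Hypothesis R_white : R \subset white_squares G.
Hypothesis black_apart : forall i (j k : 'I_n),
  G (t (i, j)).1 (t (i, j)).2 -> G (t (i, k)).1 (t (i, k)).2 -> j.+1 != k.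
Hypothesis black_inside : forall i (j : 'I_n),
  G (t (i, j)).1 (t (i, j)).2 -> (0 < j < m)%N.

Let r (i : 'I_n) (k : nat) : bool := (k < n)%N && (t (i, inord k) \in R).

Let r_ord i (k : 'I_n) : r i k = (t (i, k) \in R).
Proof. by rewrite /r ltn_ord inord_val. Qed.

Lemma card_oriented_segment i (a c : 'I_n) :
  #|R :&: oriented_segment t i a c| = (\sum_(a <= k < c.+1) r i k)%N.
Proof.
have -> : R :&: oriented_segment t i a c =
    [set t (i, k) | k in [pred k : 'I_n | (t (i, k) \in R) && (a <= k <= c)%N]].
  apply/setP=> s; apply/idP/imsetP=> [|[k + ->]]; last first.
    by rewrite !inE tK eqxx.
  rewrite -(tK s); case: (t s) => i' k; rewrite inE in_oriented_segment //.
  by case/and3P=> ? /eqP <- ?; exists k; rewrite // inE; apply/andP.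
rewrite card_imset; last by move=> k k' /(can_inj tK) [].
rewrite (big_nat_widenl _ 0%N) // (big_nat_widen _ _ n) //= big_mkord -sum1_card.
rewrite big_mkcond [RHS]big_mkcond; apply: eq_bigr => k _ /=.
by rewrite r_ord !inE ltnS; case: (_ \in R) => //=; case: ifP.
Qed.

(** Every word lies on one line, so the claim splits by lines; there [lineP] replaces alternation
    and sum 1 by the partial-sum criterion. *)
Lemma oriented_words :
  (forall W, maxset (oriented_run G t) W -> #|R :&: W| = 1%N) <->
  (forall i, alternating [seq rook_sign G R (t (i, j)) | j <- enum 'I_n] /\
             \sum_j rook_sign G R (t (i, j)) = 1).
Proof.
pose v i k : int := (r i k)%:Z - (B i k)%:Z.
have rb i k : r i k -> ~~ B i k.
  by rewrite /r /B => /andP[-> /(subsetP R_white)]; rewrite inE.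
have vE i : [seq rook_sign G R (t (i, j)) | j <- enum 'I_n] = [seq v i k | k <- iota 0 n].
  rewrite -val_enum_ord -map_comp; apply: eq_map => j /=.
  by rewrite /v r_ord B_ord.
have lineP i : reflect
    ((forall k, (k <= n)%N -> \sum_(0 <= j < k) v i j \in [:: 0; 1]) /\
       \sum_(0 <= j < n) v i j = 1)
    (alternating [seq rook_sign G R (t (i, j)) | j <- enum 'I_n] &&
       (\sum_j rook_sign G R (t (i, j)) == 1)).
  have <- : \sum_(x <- [seq rook_sign G R (t (i, j)) | j <- enum 'I_n]) x =
            \sum_j rook_sign G R (t (i, j)) by rewrite big_map big_enum.
  rewrite -prefix01P; last by apply/allP=> _ /mapP[j _ ->]; apply: rook_sign_entry.
  rewrite vE; have := prefix01_iota (v i) 0 n.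
  by rewrite /= (@big_geq _ _ _ 0%N 0%N) // add0n.
split=> [words i|lines W /max_oriented_runP[i [a [c [-> w]]]]].
  suff /lineP/andP[-> /eqP->] : (forall k, (k <= n)%N ->
     \sum_(0 <= j < k) v i j \in [:: 0; 1]) /\ \sum_(0 <= j < n) v i j = 1 by [].
  apply: (word_prefix01 (rb i)) => //.
  - move=> k; apply/contraL=> /andP[kn bk1]; apply/negP=> /andP[kn' bk].
    by have := black_apart bk bk1; rewrite !inordK // eqxx.
  - by apply/negP=> /andP[_ /black_inside]; rewrite inordK.
  - by apply/negP=> /andP[_ /black_inside]; rewrite inordK //= ltnn andbF.
  (* Segments include their last square while [line_word] excludes its end, so the end is written
     [c.+1]; an end 0 would contradict [a < 0]. *)
  move=> a [|c] w; have [/andP[ac cn] _ _ _] := w; first by [].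
  have an : (a < n)%N by lia.
  rewrite -(card_oriented_segment i (Ordinal an) (Ordinal cn)).
  by apply: words; apply/max_oriented_runP; exists i, (Ordinal an), (Ordinal cn).
rewrite card_oriented_segment; have [alt /eqP sum1] := lines i.
have /lineP[DP D1] : alternating [seq rook_sign G R (t (i, j)) | j <- enum 'I_n] &&
  (\sum_j rook_sign G R (t (i, j)) == 1) by rewrite alt.
by apply: (prefix01_word (rb i) (n := n)) => //.
Qed.

End Words.

(** * The signed matrix of a placement and the bijection *)

Definition signed_matrix n (G : crossword n) (R : {set square n}) : 'M[int]_n :=
  \matrix_(i, j) rook_sign G R (i, j).

Lemma share_edge_row n (i j k : 'I_n) :
  j.+1 == k -> share_edge (i, j) (i, k).
Proof. by rewrite /share_edge /= eqxx => ->. Qed.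

Lemma share_edge_col n (i j k : 'I_n) :
  j.+1 == k -> share_edge (j, i) (k, i).
Proof. by rewrite /share_edge /= eqxx orbC => ->. Qed.

Lemma rook_placement_asm n (G : crossword n) (R : {set square n}) :
  sparse G -> no_black_on_border G -> R \subset white_squares G ->
  complete_rook_placement G R = asm (signed_matrix G R).
Proof.
case: n G R => [|m] G R Gsparse Gborder Rw.
  (* For [n = 0] there are no lines and no words, so both sides hold vacuously. *)
  have -> : asm (signed_matrix G R).
    by apply/and5P; split; apply/forallP=> -[].
  apply/and3P; split=> //; apply/forallP=> W; apply/implyP;
    by move=> /maxsetp/andP[_ /existsP[[]]].
(* Oriented by [sw], line [i] is column [i], so [oriented_words] also handles down words. *)
pose sw (s : square m.+1) : square m.+1 := (s.2, s.1).
have swK : involutive sw by case.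
have inside s : G s.1 s.2 -> (0 < s.1 < m)%N && (0 < s.2 < m)%N.
  move=> Gs; have /Gborder : s \in black_squares G by rewrite inE.
  by have := ltn_ord s.1; have := ltn_ord s.2; rewrite /on_border; lia.
have apart s s' : G s.1 s.2 -> G s'.1 s'.2 -> ~~ share_edge s s'.
  by move=> Gs Gs'; apply: Gsparse; rewrite inE.
have rows := oriented_words (t := id) (fun=> erefl) Rw.
have {}rows := rows
  (fun i j k Gj Gk => contraNN (@share_edge_row _ i j k) (apart (i, j) (i, k) Gj Gk))
  (fun i j Gj => proj2 (andP (inside (i, j) Gj))).
have cols := oriented_words swK Rw
  (fun i j k Gj Gk => contraNN (@share_edge_col _ i j k) (apart (j, i) (k, i) Gj Gk))
  (fun i j Gj => proj1 (andP (inside (j, i) Gj))).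
apply/and3P/and5P=> [[_ across down]|[_ rsum csum ralt calt]].
  have {}/rows rows : forall W, maxset (oriented_run G id) W -> #|R :&: W| = 1%N.
    by move=> W WP; apply/eqP/(implyP (forallP across W)).
  have {}/cols cols : forall W, maxset (oriented_run G sw) W -> #|R :&: W| = 1%N.
    by move=> W WP; apply/eqP/(implyP (forallP down W)).
  split; apply/forallP=> i.
  - by apply/forallP=> j; rewrite mxE; apply: rook_sign_entry.
  - by under eq_bigr do rewrite mxE; apply/eqP; case: (rows i).
  - by under eq_bigr do rewrite mxE; apply/eqP; case: (cols i).
  - by under eq_map do rewrite mxE; case: (rows i).
  - by under eq_map do rewrite mxE; case: (cols i).
split=> //; apply/forallP=> W; apply/implyP=> WP; apply/eqP.
  apply: (rows.2 _ W WP) => i; split.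
    by have := forallP ralt i; under eq_map do rewrite mxE.
  by apply/eqP; have := forallP rsum i; under eq_bigr do rewrite mxE.
apply: (cols.2 _ W WP) => i; split.
  by have := forallP calt i; under eq_map do rewrite mxE.
by apply/eqP; have := forallP csum i; under eq_bigr do rewrite mxE.
Qed.

(** Rooks avoid black squares, so the two terms of [rook_sign] never cancel. *)
Lemma minus_one_signed_matrix n (G : crossword n) (R : {set square n}) :
  R \subset white_squares G ->
  minus_one_positions (signed_matrix G R) = black_squares G.
Proof.
move/subsetP=> Rw; apply/setP=> -[i j]; rewrite !inE mxE /rook_sign /=.
by case: (boolP (_ \in R)) => [/Rw|_]; rewrite ?inE /=; case: (G i j).
Qed.

Definition plus_one_positions n (A : 'M[int]_n) : {set square n} :=
  [set s | A s.1 s.2 == 1].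

Lemma signed_matrixK n (G : crossword n) (R : {set square n}) :
  R \subset white_squares G -> plus_one_positions (signed_matrix G R) = R.
Proof.
move/subsetP=> Rw; apply/setP=> -[i j]; rewrite !inE mxE /rook_sign /=.
by case: (boolP (_ \in R)) => [/Rw|_]; rewrite ?inE /=; case: (G i j).
Qed.

(** Once [G] fixes the positions of -1, a matrix with entries in {0, 1, -1} is determined by the
    positions of 1. *)
Lemma plus_one_positionsK n (G : crossword n) (A : 'M[int]_n) :
  asm A -> minus_one_positions A = black_squares G ->
  plus_one_positions A \subset white_squares G /\
  signed_matrix G (plus_one_positions A) = A.
Proof.
move=> /and5P[/forallP entA _ _ _ _] /setP AG.
have GE i j : G i j = (A i j == -1) by have := AG (i, j); rewrite !inE.
split; first by apply/subsetP=> -[i j]; rewrite !inE /= GE => /eqP->.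
apply/matrixP=> i j; rewrite mxE /rook_sign inE /= GE.
by have /forallP/(_ j)/sign_entryP[] := entA i => ->.
Qed.

Theorem proposition3p1 (n : nat) (G : crossword n)
    (Gsparse : sparse G) (Gborder : no_black_on_border G) :
  exists f : {R : {set square n} | complete_rook_placement G R} ->
             {A : 'M[int]_n |
               asm A && (minus_one_positions A == black_squares G)},
    bijective f.
Proof.
have white R : complete_rook_placement G R -> R \subset white_squares G.
  by case/and3P.
have fP (R : {R : {set square n} | complete_rook_placement G R}) :
    asm (signed_matrix G (val R)) &&
    (minus_one_positions (signed_matrix G (val R)) == black_squares G).
  have Rw := white _ (valP R).
  by rewrite -rook_placement_asm // (valP R) minus_one_signed_matrix /=.
have gP (A : {A : 'M[int]_n |
    asm A && (minus_one_positions A == black_squares G)}) :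
    complete_rook_placement G (plus_one_positions (val A)).
  have /andP[Aasm /eqP AG] := valP A.
  have [Aw AK] := plus_one_positionsK Aasm AG.
  (* The matrix [A] is the signed matrix of its own +1 positions, so the equivalence for placements
     applies to it. *)
  by rewrite rook_placement_asm // AK.
exists (fun R => Sub (signed_matrix G (val R)) (fP R)).
exists (fun A => Sub (plus_one_positions (val A)) (gP A)).
  by move=> R; apply: val_inj; apply: signed_matrixK (white _ (valP R)).
move=> A; apply: val_inj; have /andP[Aasm /eqP AG] := valP A.
by have [] := plus_one_positionsK Aasm AG.
Qed.
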